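(* Let $p>2$ be a prime number and let $B$ be a left cancellative left semi-brace of size $2p^2$. Suppose that $|E|=p^2$. Then, up to isomorphism, $B$ is one of the following left semi-braces: 1) $B=(\mathbb{Z}/p\mathbb{Z}\times\mathbb{Z}/p\mathbb{Z})\times\mathbb{Z}/2\mathbb{Z}$ as a set, $E=(\mathbb{Z}/p\mathbb{Z}\times\mathbb{Z}/p\mathbb{Z})\times\{0\}$, $G=\{0\}\times\mathbb{Z}/2\mathbb{Z}$, $(e_1,g_1)+(e_2,g_2)=(e_2,g_1+g_2)$ and $(e_1,g_1)\circ(e_2,g_2)=(e_1+e_2,g_1+g_2)$ for all $(e_1,g_1),(e_2,g_2)\in B$; 2) $B=\mathbb{Z}/p^2\mathbb{Z}\times\mathbb{Z}/2\mathbb{Z}$ as a set, $E=\mathbb{Z}/p^2\mathbb{Z}\times\{0\}$, $G=\{0\}\times\mathbb{Z}/2\mathbb{Z}$, $(e_1,g_1)+(e_2,g_2)=(e_2,g_1+g_2)$ and $(e_1,g_1)\circ(e_2,g_2)=(e_1+e_2,g_1+g_2)$ for all $(e_1,g_1),(e_2,g_2)\in B$; 3) $B=\mathbb{Z}/p\mathbb{Z}\times\mathbb{Z}/p\mathbb{Z}\times\mathbb{Z}/2\mathbb{Z}$ as a set, $E=\mathbb{Z}/p\mathbb{Z}\times\mathbb{Z}/p\mathbb{Z}\times\{0\}$, $G=\{0\}\times\{0\}\times\mathbb{Z}/2\mathbb{Z}$, $(e_1,f_1,g_1)+(e_2,f_2,g_2)=(e_2,f_2,g_1+g_2)$ and $(e_1,f_1,g_1)\circ(e_2,f_2,g_2)=(e_1+(-1)^{g_1}e_2,f_1+(-1)^{g_1}f_2,g_1+g_2)$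 for all $(e_1,f_1,g_1),(e_2,f_2,g_2)\in B$; 4) $B=\mathbb{Z}/p\mathbb{Z}\times\mathbb{Z}/p\mathbb{Z}\times\mathbb{Z}/2\mathbb{Z}$ as a set, $E=\mathbb{Z}/p\mathbb{Z}\times\mathbb{Z}/p\mathbb{Z}\times\{0\}$, $G=\{0\}\times\{0\}\times\mathbb{Z}/2\mathbb{Z}$, $(e_1,f_1,g_1)+(e_2,f_2,g_2)=(e_2,f_2,g_1+g_2)$ and $(e_1,f_1,g_1)\circ(e_2,f_2,g_2)=(e_1+(-1)^{g_1}e_2,f_1+f_2,g_1+g_2)$ for all $(e_1,f_1,g_1),(e_2,f_2,g_2)\in B$; 5) $B=\mathbb{Z}/p^2\mathbb{Z}\times\mathbb{Z}/2\mathbb{Z}$ as a set, $E=\mathbb{Z}/p^2\mathbb{Z}\times\{0\}$, $G=\{0\}\times\mathbb{Z}/2\mathbb{Z}$, $(e_1,g_1)+(e_2,g_2)=(e_2,g_1+g_2)$ and $(e_1,g_1)\circ(e_2,g_2)=(e_1+(-1)^{g_1}e_2,g_1+g_2)$ for all $(e_1,g_1),(e_2,g_2)\in B$.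
   Context: A left semi-brace is a triple $(B,+,\circ)$ where $(B,+)$ is a semigroup, $(B,\circ)$ is a group and $a\circ(b+c)=a\circ b+a\circ(a^-+c)$ for all $a,b,c\in B$, where $a^-$ is the inverse of $a$ in $(B,\circ)$ and $\circ$ has higher precedence than $+$. It is left cancellative if $(B,+)$ is left cancellative. The neutral element of $(B,\circ)$ is denoted by $0$. For a left cancellative left semi-brace $B$, $G:=B+0=\{b+0\mid b\in B\}$, which is a subgroup of $(B,\circ)$, and $E$ is the set of idempotents of $(B,+)$, which is also a subgroup of $(B,\circ)$. Isomorphisms are bijections preserving both operations. Inside the components, $+$ is the usual modular addition. *)

(* Defs.v *)
From HB Require Import structures.
From mathcomp Require Import all_boot all_order all_fingroup all_algebra.

Set Implicit Arguments.
Unset Strict Implicit.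
Unset Printing Implicit Defensive.

Import GRing.Theory.

(* A (finite) left semi-brace: the group (B, o) is the ambient finite group,
   so "a o b" is [a * b], "a^-" is [a^-1] and the neutral element, written 0 in
   the semi-brace literature, is [1]; the semigroup addition is [sbadd]. *)
HB.mixin Record FinGroup_isLeftSemiBrace B of FinGroup B := {
  sbadd : B -> B -> B;
  sbaddA : associative sbadd;
  mul_sbadd : forall a b c : B,
    (a * sbadd b c = sbadd (a * b) (a * sbadd a^-1 c))%g
}.

#[short(type="leftSemiBraceType")]
HB.structure Definition LeftSemiBrace :=
  { B of FinGroup_isLeftSemiBrace B & FinGroup B }.

Section LeftSemiBraceDefs.
Variable B : leftSemiBraceType.

Definition left_cancellative : Prop := forall a : B, injective (sbadd a).

Definition sbE : {set B} := [set b | sbadd b b == b].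

Definition sbG : {set B} := [set sbadd b 1%g | b : B].

End LeftSemiBraceDefs.

Definition sb_isomorphic (B C : leftSemiBraceType) : Prop :=
  exists f : B -> C,
    [/\ bijective f,
        {morph f : a b / sbadd a b} &
        {morph f : a b / (a * b)%g}].

(* The model semi-braces live on aliases of product types, so that their group
   law is not the componentwise one which those products already carry.
   They are meant for p > 1 only ('Z_p is Z/2Z when p <= 1), and
   [(-1) ^+ g] uses the representative 0 or 1 of g : 'Z_2. *)

Local Open Scope ring_scope.

Fact exprN1_Z2D (R : pzRingType) (g h : 'Z_2) :
  (-1) ^+ (g + h)%R = (-1) ^+ g * (-1) ^+ h :> R.
Proof.
by rewrite -exprD /= -[RHS]signr_odd -[LHS]signr_odd !modn2 !oddb.
Qed.

Fact Z2_sbadd (g h k : 'Z_2) : g + (h + k) = (g + h) + (g + (- g + k)).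
Proof. by rewrite addNKr addrA. Qed.

Definition ZpZp_Z2_dir (p : nat) : Type := ('Z_p * 'Z_p) * 'Z_2.

Section ZpZp_Z2_dir.
Variable p : nat.
Implicit Types x y : ZpZp_Z2_dir p.

HB.instance Definition _ := Finite.copy (ZpZp_Z2_dir p) (('Z_p * 'Z_p) * 'Z_2)%type.

Definition ZpZp_Z2_dir_add x y : ZpZp_Z2_dir p :=
  let: (e1, g1) := x in let: (e2, g2) := y in
  (e2, g1 + g2).
Definition ZpZp_Z2_dir_mul x y : ZpZp_Z2_dir p :=
  let: (e1, g1) := x in let: (e2, g2) := y in
  (e1 + e2, g1 + g2).
Definition ZpZp_Z2_dir_one : ZpZp_Z2_dir p := (0, 0).
Definition ZpZp_Z2_dir_inv x : ZpZp_Z2_dir p :=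
  let: (e, g) := x in (- e, - g).

Fact ZpZp_Z2_dir_mulA : associative ZpZp_Z2_dir_mul.
Proof.
by move=> [e1 g1] [e2 g2] [e3 g3]; rewrite /ZpZp_Z2_dir_mul ?exprN1_Z2D ?mulrDr ?mulrA ?addrA.
Qed.
Fact ZpZp_Z2_dir_mul1 : left_id ZpZp_Z2_dir_one ZpZp_Z2_dir_mul.
Proof. by move=> [e g]; rewrite /ZpZp_Z2_dir_mul /ZpZp_Z2_dir_one ?expr0 ?mul1r !add0r. Qed.
Fact ZpZp_Z2_dir_mulV : left_inverse ZpZp_Z2_dir_one ZpZp_Z2_dir_inv ZpZp_Z2_dir_mul.
Proof. by move=> [e g]; rewrite /ZpZp_Z2_dir_mul /ZpZp_Z2_dir_inv !addNr. Qed.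
HB.instance Definition _ :=
  Finite_isGroup.Build (ZpZp_Z2_dir p) ZpZp_Z2_dir_mulA ZpZp_Z2_dir_mul1 ZpZp_Z2_dir_mulV.

Fact ZpZp_Z2_dir_addA : associative ZpZp_Z2_dir_add.
Proof. by move=> [e1 g1] [e2 g2] [e3 g3]; rewrite /ZpZp_Z2_dir_add addrA. Qed.
Fact ZpZp_Z2_dir_brace (a b c : ZpZp_Z2_dir p) :
  (a * ZpZp_Z2_dir_add b c =
   ZpZp_Z2_dir_add (a * b) (a * ZpZp_Z2_dir_add a^-1 c))%g.
Proof.
by case: a b c => [e1 g1] [e2 g2] [e3 g3]; congr pair; apply: Z2_sbadd.
Qed.
HB.instance Definition _ :=
  FinGroup_isLeftSemiBrace.Build (ZpZp_Z2_dir p) ZpZp_Z2_dir_addA ZpZp_Z2_dir_brace.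
End ZpZp_Z2_dir.

Definition Zp2_Z2_dir (p : nat) : Type := 'Z_(p ^ 2) * 'Z_2.

Section Zp2_Z2_dir.
Variable p : nat.
Implicit Types x y : Zp2_Z2_dir p.

HB.instance Definition _ := Finite.copy (Zp2_Z2_dir p) ('Z_(p ^ 2) * 'Z_2)%type.

Definition Zp2_Z2_dir_add x y : Zp2_Z2_dir p :=
  let: (e1, g1) := x in let: (e2, g2) := y in
  (e2, g1 + g2).
Definition Zp2_Z2_dir_mul x y : Zp2_Z2_dir p :=
  let: (e1, g1) := x in let: (e2, g2) := y in
  (e1 + e2, g1 + g2).
Definition Zp2_Z2_dir_one : Zp2_Z2_dir p := (0, 0).
Definition Zp2_Z2_dir_inv x : Zp2_Z2_dir p :=
  let: (e, g) := x in (- e, - g).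

Fact Zp2_Z2_dir_mulA : associative Zp2_Z2_dir_mul.
Proof.
by move=> [e1 g1] [e2 g2] [e3 g3]; rewrite /Zp2_Z2_dir_mul ?exprN1_Z2D ?mulrDr ?mulrA ?addrA.
Qed.
Fact Zp2_Z2_dir_mul1 : left_id Zp2_Z2_dir_one Zp2_Z2_dir_mul.
Proof. by move=> [e g]; rewrite /Zp2_Z2_dir_mul /Zp2_Z2_dir_one ?expr0 ?mul1r !add0r. Qed.
Fact Zp2_Z2_dir_mulV : left_inverse Zp2_Z2_dir_one Zp2_Z2_dir_inv Zp2_Z2_dir_mul.
Proof. by move=> [e g]; rewrite /Zp2_Z2_dir_mul /Zp2_Z2_dir_inv !addNr. Qed.
HB.instance Definition _ :=
  Finite_isGroup.Build (Zp2_Z2_dir p) Zp2_Z2_dir_mulA Zp2_Z2_dir_mul1 Zp2_Z2_dir_mulV.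

Fact Zp2_Z2_dir_addA : associative Zp2_Z2_dir_add.
Proof. by move=> [e1 g1] [e2 g2] [e3 g3]; rewrite /Zp2_Z2_dir_add addrA. Qed.
Fact Zp2_Z2_dir_brace (a b c : Zp2_Z2_dir p) :
  (a * Zp2_Z2_dir_add b c =
   Zp2_Z2_dir_add (a * b) (a * Zp2_Z2_dir_add a^-1 c))%g.
Proof.
by case: a b c => [e1 g1] [e2 g2] [e3 g3]; congr pair; apply: Z2_sbadd.
Qed.
HB.instance Definition _ :=
  FinGroup_isLeftSemiBrace.Build (Zp2_Z2_dir p) Zp2_Z2_dir_addA Zp2_Z2_dir_brace.
End Zp2_Z2_dir.

Definition ZpZp_Z2_inv (p : nat) : Type := 'Z_p * 'Z_p * 'Z_2.

Section ZpZp_Z2_inv.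
Variable p : nat.
Implicit Types x y : ZpZp_Z2_inv p.

HB.instance Definition _ := Finite.copy (ZpZp_Z2_inv p) ('Z_p * 'Z_p * 'Z_2)%type.

Definition ZpZp_Z2_inv_add x y : ZpZp_Z2_inv p :=
  let: (e1, f1, g1) := x in let: (e2, f2, g2) := y in
  (e2, f2, g1 + g2).
Definition ZpZp_Z2_inv_mul x y : ZpZp_Z2_inv p :=
  let: (e1, f1, g1) := x in let: (e2, f2, g2) := y in
  (e1 + (-1) ^+ g1 * e2, f1 + (-1) ^+ g1 * f2, g1 + g2).
Definition ZpZp_Z2_inv_one : ZpZp_Z2_inv p := (0, 0, 0).
Definition ZpZp_Z2_inv_inv x : ZpZp_Z2_inv p :=
  let: (e, f, g) := x in (- ((-1) ^+ (- g)%R * e), - ((-1) ^+ (- g)%R * f), - g).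

Fact ZpZp_Z2_inv_mulA : associative ZpZp_Z2_inv_mul.
Proof.
by move=> [[e1 f1] g1] [[e2 f2] g2] [[e3 f3] g3]; rewrite /ZpZp_Z2_inv_mul ?exprN1_Z2D ?mulrDr ?mulrA ?addrA.
Qed.
Fact ZpZp_Z2_inv_mul1 : left_id ZpZp_Z2_inv_one ZpZp_Z2_inv_mul.
Proof. by move=> [[e f] g]; rewrite /ZpZp_Z2_inv_mul /ZpZp_Z2_inv_one ?expr0 ?mul1r !add0r. Qed.
Fact ZpZp_Z2_inv_mulV : left_inverse ZpZp_Z2_inv_one ZpZp_Z2_inv_inv ZpZp_Z2_inv_mul.
Proof. by move=> [[e f] g]; rewrite /ZpZp_Z2_inv_mul /ZpZp_Z2_inv_inv !addNr. Qed.
HB.instance Definition _ :=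
  Finite_isGroup.Build (ZpZp_Z2_inv p) ZpZp_Z2_inv_mulA ZpZp_Z2_inv_mul1 ZpZp_Z2_inv_mulV.

Fact ZpZp_Z2_inv_addA : associative ZpZp_Z2_inv_add.
Proof. by move=> [[e1 f1] g1] [[e2 f2] g2] [[e3 f3] g3]; rewrite /ZpZp_Z2_inv_add addrA. Qed.
Fact ZpZp_Z2_inv_brace (a b c : ZpZp_Z2_inv p) :
  (a * ZpZp_Z2_inv_add b c =
   ZpZp_Z2_inv_add (a * b) (a * ZpZp_Z2_inv_add a^-1 c))%g.
Proof.
by case: a b c => [[e1 f1] g1] [[e2 f2] g2] [[e3 f3] g3]; congr pair; apply: Z2_sbadd.
Qed.
HB.instance Definition _ :=
  FinGroup_isLeftSemiBrace.Build (ZpZp_Z2_inv p) ZpZp_Z2_inv_addA ZpZp_Z2_inv_brace.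
End ZpZp_Z2_inv.

Definition ZpZp_Z2_semi (p : nat) : Type := 'Z_p * 'Z_p * 'Z_2.

Section ZpZp_Z2_semi.
Variable p : nat.
Implicit Types x y : ZpZp_Z2_semi p.

HB.instance Definition _ := Finite.copy (ZpZp_Z2_semi p) ('Z_p * 'Z_p * 'Z_2)%type.

Definition ZpZp_Z2_semi_add x y : ZpZp_Z2_semi p :=
  let: (e1, f1, g1) := x in let: (e2, f2, g2) := y in
  (e2, f2, g1 + g2).
Definition ZpZp_Z2_semi_mul x y : ZpZp_Z2_semi p :=
  let: (e1, f1, g1) := x in let: (e2, f2, g2) := y in
  (e1 + (-1) ^+ g1 * e2, f1 + f2, g1 + g2).
Definition ZpZp_Z2_semi_one : ZpZp_Z2_semi p := (0, 0, 0).
Definition ZpZp_Z2_semi_inv x : ZpZp_Z2_semi p :=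
  let: (e, f, g) := x in (- ((-1) ^+ (- g)%R * e), - f, - g).

Fact ZpZp_Z2_semi_mulA : associative ZpZp_Z2_semi_mul.
Proof.
by move=> [[e1 f1] g1] [[e2 f2] g2] [[e3 f3] g3]; rewrite /ZpZp_Z2_semi_mul ?exprN1_Z2D ?mulrDr ?mulrA ?addrA.
Qed.
Fact ZpZp_Z2_semi_mul1 : left_id ZpZp_Z2_semi_one ZpZp_Z2_semi_mul.
Proof. by move=> [[e f] g]; rewrite /ZpZp_Z2_semi_mul /ZpZp_Z2_semi_one ?expr0 ?mul1r !add0r. Qed.
Fact ZpZp_Z2_semi_mulV : left_inverse ZpZp_Z2_semi_one ZpZp_Z2_semi_inv ZpZp_Z2_semi_mul.
Proof. by move=> [[e f] g]; rewrite /ZpZp_Z2_semi_mul /ZpZp_Z2_semi_inv !addNr. Qed.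
HB.instance Definition _ :=
  Finite_isGroup.Build (ZpZp_Z2_semi p) ZpZp_Z2_semi_mulA ZpZp_Z2_semi_mul1 ZpZp_Z2_semi_mulV.

Fact ZpZp_Z2_semi_addA : associative ZpZp_Z2_semi_add.
Proof. by move=> [[e1 f1] g1] [[e2 f2] g2] [[e3 f3] g3]; rewrite /ZpZp_Z2_semi_add addrA. Qed.
Fact ZpZp_Z2_semi_brace (a b c : ZpZp_Z2_semi p) :
  (a * ZpZp_Z2_semi_add b c =
   ZpZp_Z2_semi_add (a * b) (a * ZpZp_Z2_semi_add a^-1 c))%g.
Proof.
by case: a b c => [[e1 f1] g1] [[e2 f2] g2] [[e3 f3] g3]; congr pair; apply: Z2_sbadd.
Qed.
HB.instance Definition _ :=
  FinGroup_isLeftSemiBrace.Build (ZpZp_Z2_semi p) ZpZp_Z2_semi_addA ZpZp_Z2_semi_brace.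
End ZpZp_Z2_semi.

Definition Zp2_Z2_inv (p : nat) : Type := 'Z_(p ^ 2) * 'Z_2.

Section Zp2_Z2_inv.
Variable p : nat.
Implicit Types x y : Zp2_Z2_inv p.

HB.instance Definition _ := Finite.copy (Zp2_Z2_inv p) ('Z_(p ^ 2) * 'Z_2)%type.

Definition Zp2_Z2_inv_add x y : Zp2_Z2_inv p :=
  let: (e1, g1) := x in let: (e2, g2) := y in
  (e2, g1 + g2).
Definition Zp2_Z2_inv_mul x y : Zp2_Z2_inv p :=
  let: (e1, g1) := x in let: (e2, g2) := y in
  (e1 + (-1) ^+ g1 * e2, g1 + g2).
Definition Zp2_Z2_inv_one : Zp2_Z2_inv p := (0, 0).
Definition Zp2_Z2_inv_inv x : Zp2_Z2_inv p :=
  let: (e, g) := x in (- ((-1) ^+ (- g)%R * e), - g).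

Fact Zp2_Z2_inv_mulA : associative Zp2_Z2_inv_mul.
Proof.
by move=> [e1 g1] [e2 g2] [e3 g3]; rewrite /Zp2_Z2_inv_mul ?exprN1_Z2D ?mulrDr ?mulrA ?addrA.
Qed.
Fact Zp2_Z2_inv_mul1 : left_id Zp2_Z2_inv_one Zp2_Z2_inv_mul.
Proof. by move=> [e g]; rewrite /Zp2_Z2_inv_mul /Zp2_Z2_inv_one ?expr0 ?mul1r !add0r. Qed.
Fact Zp2_Z2_inv_mulV : left_inverse Zp2_Z2_inv_one Zp2_Z2_inv_inv Zp2_Z2_inv_mul.
Proof. by move=> [e g]; rewrite /Zp2_Z2_inv_mul /Zp2_Z2_inv_inv !addNr. Qed.
HB.instance Definition _ :=
  Finite_isGroup.Build (Zp2_Z2_inv p) Zp2_Z2_inv_mulA Zp2_Z2_inv_mul1 Zp2_Z2_inv_mulV.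

Fact Zp2_Z2_inv_addA : associative Zp2_Z2_inv_add.
Proof. by move=> [e1 g1] [e2 g2] [e3 g3]; rewrite /Zp2_Z2_inv_add addrA. Qed.
Fact Zp2_Z2_inv_brace (a b c : Zp2_Z2_inv p) :
  (a * Zp2_Z2_inv_add b c =
   Zp2_Z2_inv_add (a * b) (a * Zp2_Z2_inv_add a^-1 c))%g.
Proof.
by case: a b c => [e1 g1] [e2 g2] [e3 g3]; congr pair; apply: Z2_sbadd.
Qed.
HB.instance Definition _ :=
  FinGroup_isLeftSemiBrace.Build (Zp2_Z2_inv p) Zp2_Z2_inv_addA Zp2_Z2_inv_brace.
End Zp2_Z2_inv.

(* Main.v *)
(* For [a] in [B] let [lambda a c = a o (a^- + c)]; this is an action of [(B, o)]
   on [(B, +)] by automorphisms.  Then [G] is the stabiliser of [0] (written [1]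
   here) and [E] acts on itself regularly, so that [B] is the exact product
   [E o G], and when [E] is normal the addition is forced to be
   [(e o g) + (f o h) = f o (g + h)].  Here [E] has index 2, so everything is
   determined by the conjugation action of the involution [t] of [G] on [E].
   If [E] is cyclic, [t] acts as [1] or [-1], since [k^2 = 1] mod [p^2] forces
   [k = 1] or [k = -1].  Otherwise [E] has exponent [p] and is the direct
   product of two cyclic groups on each of which [t] acts as [1] or [-1]. *)
Require Import Defs.
From mathcomp Require Import all_boot all_order all_fingroup all_algebra.
From mathcomp Require Import all_solvable.

Set Implicit Arguments.
Unset Strict Implicit.
Unset Printing Implicit Defensive.

Import GRing.Theory.

(** * The action [lambda] and the exact factorisation of [B] into [E] and [G] *)

Section LambdaMap.
Local Open Scope group_scope.
Variable B : leftSemiBraceType.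
Hypothesis B_lcanc : left_cancellative B.
Implicit Types a b c e f g h : B.

Definition lambda a c : B := a * sbadd a^-1 c.

Lemma lambdaD a : {morph lambda a : b c / sbadd b c}.
Proof. by move=> b c; rewrite /lambda sbaddA mul_sbadd. Qed.

Lemma lambdaM a b c : lambda (a * b) c = lambda a (lambda b c).
Proof. by rewrite {1}/lambda invMg -mulgA (mul_sbadd b) mulKVg. Qed.

Lemma sbadd_lambda a c : sbadd a c = a * lambda a^-1 c.
Proof. by rewrite /lambda invgK mulKVg. Qed.

(** The axiom at [a = b = 1] reads [1 + c = 1 + (1 + c)], and the left [1] cancels. *)
Lemma sbadd1l c : sbadd 1 c = c.
Proof.
apply: (B_lcanc (a := 1)); have := mul_sbadd 1 1 c.
by rewrite invg1 !mul1g.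
Qed.

Lemma lambda1 c : lambda 1 c = c.
Proof. by rewrite /lambda invg1 mul1g sbadd1l. Qed.

(** If [e + e = e], then [e + (e + c) = e + c], and cancelling [e] makes it left neutral. *)
Lemma sbEP e : reflect (forall c, sbadd e c = c) (e \in sbE B).
Proof.
rewrite inE; apply: (iffP eqP) => [ee c | -> //].
by apply: (B_lcanc (a := e)); rewrite sbaddA ee.
Qed.

(** The axiom for [e o (1 + c)] gives [e + lambda e c] on the right, where the left neutral [e]
    disappears. Hence [E] acts by left translations. *)
Lemma lambda_sbE e c : e \in sbE B -> lambda e c = e * c.
Proof.
move=> /sbEP eE; have := mul_sbadd e 1 c.
by rewrite sbadd1l mulg1 -/(lambda e c) eE.
Qed.

Lemma sbE_group_set : group_set (sbE B).
Proof.
apply/group_setP; split=> [|e f eE fE]; first by apply/sbEP; apply: sbadd1l.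
(* The third argument is chosen so that [lambda e] sends it to [c]; the axiom then becomes
   [c = (e o f) + c]. *)
apply/sbEP => c; have := mul_sbadd e f (e^-1 * c).
by rewrite (sbEP _ fE) -/(lambda e _) (lambda_sbE _ eE) mulKVg => <-.
Qed.

#[local] Canonical sbE_group := Group sbE_group_set.

Lemma sbGE g : (g \in sbG B) = (sbadd g 1 == g).
Proof.
apply/imsetP/eqP => [[b _ ->] | g1]; first by rewrite -sbaddA sbadd1l.
by exists g.
Qed.

(** The axiom at [b = c = 1] gives [g = g + lambda g 1]. By cancellation, [g + 1 = g] exactly when
    [g] stabilises [1]. *)
Lemma sbGP g : reflect (lambda g 1 = 1) (g \in sbG B).
Proof.
have gE : g = sbadd g (lambda g 1).
  by have := mul_sbadd g 1 1; rewrite sbadd1l mulg1.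
rewrite sbGE; apply: (iffP eqP) => [g1 | g1]; last by rewrite -{1}g1 -gE.
by apply: (B_lcanc (a := g)); rewrite -gE g1.
Qed.

Lemma sbG_group_set : group_set (sbG B).
Proof.
apply/group_setP; split=> [|g h /sbGP g1 /sbGP h1]; apply/sbGP.
  exact: lambda1.
by rewrite lambdaM h1.
Qed.

#[local] Canonical sbG_group := Group sbG_group_set.

Lemma lambda1_sbE a : lambda a 1 \in sbE B.
Proof. by rewrite inE -lambdaD sbadd1l. Qed.

Lemma sbEG_mul : sbE B * sbG B = [set: B].
Proof.
apply/setP => b; rewrite inE.
have bE := lambda1_sbE b.
(* With [e = lambda b 1], which is idempotent, the cofactor [e^- o b] fixes [1], because
   [lambda e^- e = e^- o e]. *)
rewrite -(mulKVg (lambda b 1) b) mem_mulg //; apply/sbGP.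
by rewrite lambdaM lambda_sbE ?groupV // mulVg.
Qed.

Lemma sbEG_TI : sbE B :&: sbG B = 1.
Proof.
apply/trivgP/subsetP => e /setIP[eE /sbGP].
by rewrite lambda_sbE // mulg1 => ->; rewrite set11.
Qed.

(** Since [e] acts as a translation, the left side is the action of [g o e] on [h]; normality allows
    [g o e] to be rewritten as an element of [E] followed by [g]. *)
Lemma lambda_sbE_mul g e h : sbE B <| [set: B] ->
  g \in sbG B -> e \in sbE B -> lambda g (e * h) = e ^ g^-1 * lambda g h.
Proof.
move=> /fingroup.normalP[_ nE] gG eE; rewrite -(@lambda_sbE e) // -lambdaM.
have egE : e ^ g^-1 \in sbE B by rewrite -(nE g^-1) ?inE // memJ_conjg.
by rewrite -(lambda_sbE _ egE) -lambdaM conjgE invgK mulgA mulgKV.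
Qed.

(** In [x + y = x o lambda x^- y], the part [e] of [x] cancels against the translation by [e^-], and
    the conjugation by [g] is undone by [g] itself. *)
Lemma sbadd_factor e g f h : sbE B <| [set: B] ->
    e \in sbE B -> g \in sbG B -> f \in sbE B ->
  sbadd (e * g) (f * h) = f * sbadd g h.
Proof.
move=> nE eE gG fE; rewrite !sbadd_lambda invMg lambdaM.
rewrite (@lambda_sbE e^-1) ?groupV // (mulgA e^-1).
rewrite lambda_sbE_mul ?groupV ?groupM ?groupV //.
by rewrite invgK conjgE !mulgA !mulgK mulgV mul1g.
Qed.

End LambdaMap.

(** * Idempotents of index two: the involution of [G] and a criterion for isomorphism *)

Section Index2.
Local Open Scope group_scope.
Variable B : leftSemiBraceType.
Hypothesis B_lcanc : left_cancellative B.
Hypothesis cardB : #|B| = (2 * #|sbE B|)%N.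

Lemma sbE_normal : sbE B <| [set: B].
Proof.
apply: (@index2_normal _ [set: B]%G (sbE_group B_lcanc)); rewrite ?subsetT //.
apply/eqP; rewrite -(eqn_pmul2l (cardG_gt0 (sbE_group B_lcanc))).
by rewrite Lagrange ?subsetT // cardsT cardB mulnC.
Qed.

Lemma sbG_involution :
  exists2 t, t \in sbG B & [/\ t != 1, t * t = 1 & sbadd t t = 1].
Proof.
have cardG : #|sbG B| = 2.
  apply/eqP; rewrite -(eqn_pmul2l (cardG_gt0 (sbE_group B_lcanc))).
  rewrite -[X in (_ * X)%N]/(#|sbG_group B_lcanc|) -TI_cardMg ?sbEG_TI //=.
  by rewrite sbEG_mul // cardsT cardB mulnC.
have /trivgPn[t tG t1] : sbG_group B_lcanc :!=: 1 by rewrite -cardG_gt1 cardG.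
have defG : sbG B = [set 1; t].
  apply/esym/eqP; rewrite eqEcard cardG cards2 eq_sym t1 andbT.
  by apply/subsetP => x /set2P[] -> //; apply: (group1 (sbG_group B_lcanc)).
exists t => //; split=> //.
  have := groupM (G := sbG_group B_lcanc) tG tG.
  rewrite /= defG => /set2P[// | /eqP].
  by rewrite -{3}(mulg1 t) (inj_eq (mulgI t)) (negPf t1).
(* Closure under addition leaves [1] and [t] as values. The value [t] is impossible: with
   [t + 1 = t], left cancellation would give [t = 1]. *)
have : sbadd t t \in sbG B.
  by move: tG; rewrite !sbGE // -sbaddA => /eqP ->.
rewrite defG => /set2P[// | ttt].
move: tG; rewrite sbGE // -{2}ttt => /eqP/(B_lcanc (a := t)) t1'.
by rewrite -t1' eqxx in t1.
Qed.

(** One criterion serves all five models: [k] gives coordinates on [C], [iota] embeds the first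
    coordinate in [E], and [s] is conjugation by [t] read through [iota]. The map sends [(a, g)] to
    [iota a o t^g]; it is injective because [E] and [G] meet trivially, hence bijective by
    cardinality, and its inverse is the isomorphism sought. *)
Lemma sb_isomorphic_model (A : zmodType) (C : leftSemiBraceType) (t : B)
    (k : C -> A * 'Z_2) (s : A -> A) (iota : A -> B) :
  t \in sbG B -> t != 1 -> t * t = 1 -> sbadd t t = 1 ->
  #|C| = #|B| -> injective k ->
  (forall x y, k (sbadd x y) = ((k y).1, (k x).2 + (k y).2)%R) ->
  (forall x y, k (x * y) =
     ((k x).1 + (if (k x).2 == 0 then (k y).1 else s (k y).1), (k x).2 + (k y).2)%R) ->
  injective iota -> (forall a, iota a \in sbE B) ->
  {morph iota : a b / (a + b)%R >-> a * b} ->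
  (forall a, iota (s a) = iota a ^ t) ->
  sb_isomorphic B C.
Proof.
move=> tG t1 tt ttD cardC k_inj kD kM iota_inj iotaE iotaD iotaJ.
pose h x := iota (k x).1 * t ^+ (k x).2.
have tgG (g : 'Z_2) : t ^+ g \in sbG B by apply: (groupX (G := sbG_group B_lcanc)).
have tgM (g1 g2 : 'Z_2) : t ^+ (g1 + g2)%R = t ^+ g1 * t ^+ g2.
  by rewrite -expgD expg_mod // expgS expg1.
have tgD (g1 g2 : 'Z_2) : t ^+ (g1 + g2)%R = sbadd (t ^+ g1) (t ^+ g2).
  have ds (g : 'Z_2) : g = 0%R \/ g = 1%R.
    by case: g => [[|[|m]] lt_m] //; [left | right]; apply: val_inj.
  have t1D : sbadd t 1 = t by apply/eqP; rewrite -sbGE.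
  by case: (ds g1) => ->; case: (ds g2) => -> /=;
    rewrite ?expg1 ?expg0 ?sbadd1l ?t1D ?ttD.
have h_inj : injective h.
  move=> x y hxy; apply: k_inj.
  have eq_gE : (iota (k y).1)^-1 * iota (k x).1 = t ^+ (k y).2 * (t ^+ (k x).2)^-1.
    by apply: (mulgI (iota (k y).1)); rewrite mulKVg mulgA -/(h y) -hxy mulgK.
  have : (iota (k y).1)^-1 * iota (k x).1 \in sbE B :&: sbG B.
    rewrite inE (groupM (G := sbE_group B_lcanc)) ?(groupV (sbE_group B_lcanc)) //=.
    by rewrite eq_gE (groupM (G := sbG_group B_lcanc)) ?(groupV (sbG_group B_lcanc)).
  rewrite sbEG_TI // => /set1P ee1.
  have exy : (k x).1 = (k y).1.
    by apply: iota_inj; rewrite -[RHS]mulg1 -ee1 mulKVg.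
  have gxy : t ^+ (k x).2 = t ^+ (k y).2.
    by move: hxy; rewrite /h exy => /mulgI.
  rewrite [k x]surjective_pairing [k y]surjective_pairing exy; congr (_, _).
  move: gxy; case: (k x).2 (k y).2 => [[|[|m]] lt_m] [[|[|n]] lt_n] //=;
    rewrite ?expg1 ?expg0 => t1'; try exact: val_inj.
    by rewrite -t1' eqxx in t1.
  by rewrite t1' eqxx in t1.
have hD : {morph h : x y / sbadd x y}.
  by move=> x y; rewrite /h kD /= tgD sbadd_factor // sbE_normal.
have hM : {morph h : x y / x * y}.
  move=> x y; rewrite /h kM /= tgM iotaD !mulgA; congr (_ * _).
  rewrite -!mulgA; congr (_ * _).
  (* Only the second coordinate 1 twists the product; moving [t] past [iota] is conjugation by
     [t^-1], which equals [t]. *)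
  case: (k x).2 => [[|[|m]] lt_m] //=; first by rewrite expg0 mulg1 mul1g.
  have tV : t^-1 = t by apply/eqP; rewrite eq_invg_mul tt.
  by rewrite expg1 iotaJ conjgE tV -!mulgA tt mulg1.
have [f hK fK] : bijective h by apply: inj_card_bij; rewrite ?cardC.
exists f; split; first by exists h.
  by move=> x y; apply: h_inj; rewrite hD !fK.
by move=> x y; apply: h_inj; rewrite hM !fK.
Qed.

End Index2.

(** * Powers with exponents in Z/n *)

Section ZpPowers.
Local Open Scope group_scope.
Variables (gT : finGroupType) (n : nat) (x : gT).
Hypotheses (n_gt1 : 1 < n) (xn : x ^+ n = 1).

Lemma expg_ZpD (a b : 'Z_n) : x ^+ (a + b)%R = x ^+ a * x ^+ b.
Proof. by rewrite -expgD /= expg_mod // Zp_cast. Qed.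

Lemma expg_ZpN (a : 'Z_n) : x ^+ (- a)%R = (x ^+ a)^-1.
Proof. by apply/esym/eqP; rewrite eq_invg_mul -expg_ZpD subrr. Qed.

End ZpPowers.

Lemma expg_Zp_inj (gT : finGroupType) (n : nat) (x : gT) :
  1 < n -> #[x]%g = n -> injective (fun a : 'Z_n => x ^+ a)%g.
Proof.
move=> n_gt1 ox a b /eqP; rewrite eq_expg_mod_order ox.
have lt_n (c : 'Z_n) : c < n by have := ltn_ord c; rewrite [X in _ < X]Zp_cast.
by rewrite !modn_small // => /eqP/val_inj.
Qed.

(** * Conjugation by an involution on a group of order [p^2] *)

Section InvolutionOnGroupOfOrderP2.
Local Open Scope group_scope.
Variables (gT : finGroupType) (E : {group gT}) (p : nat) (t : gT).
Hypotheses (p_gt2 : 2 < p) (p_prime : prime p) (cardE : #|E| = (p ^ 2)%N).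
Hypotheses (tN : t \in 'N(E)) (tt : t * t = 1).

Let conjtt x : (x ^ t) ^ t = x.
Proof. by rewrite -conjgM tt conjg1. Qed.

Lemma cyclic_involution : cyclic E ->
  exists2 x, x \in E & #[x] = (p ^ 2)%N /\ (x ^ t = x \/ x ^ t = x^-1).
Proof.
case/cyclicP => x defE; have xE : x \in E by rewrite defE cycle_id.
have ox : #[x] = (p ^ 2)%N by rewrite /order -defE.
exists x => //; split=> //.
have /cycleP[k xt] : x ^ t \in <[x]> by rewrite -defE memJ_norm.
have : x ^+ (k * k) == x ^+ 1 by rewrite expgM -xt -conjXg -xt conjtt expg1.
(* Exponent 0 would force [p^2] to divide 1. Writing the exponent as [k.+1] turns the congruence
   into [p^2] dividing [k * k.+2]; as [p > 2] cannot divide both factors, [p^2] divides one of them,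
   which gives the two signs. *)
rewrite eq_expg_mod_order ox; case: k xt => [|k] xt.
  rewrite mul0n eq_sym eqn_mod_dvd // dvdn1 => /eqP p2_1.
  by move: p_gt2; rewrite -(ltn_exp2r 2 p (e := 2)) // p2_1.
rewrite eqn_mod_dvd ?muln_gt0 // (_ : k.+1 * k.+1 - 1 = k * k.+2)%N; last first.
  by rewrite mulSn addSn subn1 /= -mulnS.
move=> p2_k; have [p_k | pNk] := boolP (p %| k)%N; [left | right].
  have pNk2 : coprime (p ^ 2) k.+2.
    rewrite coprime_pexpl // prime_coprime // -addn2 dvdn_addr //.
    by apply: contraL p_gt2 => /dvdn_leq; rewrite -leqNgt => ->.
  move: p2_k; rewrite Gauss_dvdl // -ox order_dvdn => /eqP xk.
  by rewrite xt expgS xk mulg1.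
have coNk : coprime (p ^ 2) k by rewrite coprime_pexpl // prime_coprime.
move: p2_k; rewrite Gauss_dvdr // -ox order_dvdn => /eqP xk.
by rewrite xt; apply/esym/eqP; rewrite eq_invg_mul -expgS xk.
Qed.

Lemma noncyclic_involution : ~~ cyclic E ->
  exists u v, [/\ u \in E, v \in E, #[u] = p, #[v] = p & <[u]> :&: <[v]> = 1]
  /\ [\/ u ^ t = u /\ v ^ t = v, u ^ t = u^-1 /\ v ^ t = v^-1
       | u ^ t = u^-1 /\ v ^ t = v].
Proof.
move=> ncE; have cEE := card_p2group_abelian p_prime cardE.
have oE x : x \in E -> x != 1 -> #[x] = p.
  move=> xE x1; have := order_dvdG xE; rewrite cardE.
  case/(dvdn_pfactor _ _ p_prime) => [[|[|[|m]]]] // _ ox.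
    by rewrite -order_eq1 ox in x1.
  case/negP: ncE; apply/cyclicP; exists x; apply/esym/eqP.
  by rewrite eqEcard cycle_subG xE cardE -ox /=.
have xtE x : x \in E -> x ^ t \in E by rewrite memJ_norm.
have commE x y : x \in E -> y \in E -> x * y = y * x.
  by move=> xE yE; apply: (centsP cEE).
(* A basis for the cases where [t] acts as a scalar: any nontrivial [v], and any [u] outside the
   subgroup it generates. *)
have gen : exists u v, [/\ u \in E, v \in E, #[u] = p, #[v] = p & <[u]> :&: <[v]> = 1].
  have /trivgPn[v vE v1] : E :!=: 1.
    by rewrite -cardG_gt1 cardE (@ltn_exp2l p 0 2) // ltnW.
  have /subsetPn[u uE uv] : ~~ (E \subset <[v]>).
    apply: contra ncE => sEv; apply/cyclicP; exists v; apply/eqP.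
    by rewrite eqEsubset sEv cycle_subG.
  have u1 : u != 1 by apply: contraNneq uv => ->.
  exists u, v; split; rewrite ?oE //.
  by apply: prime_TIg; rewrite ?cycle_subG // -orderE oE.
have [allF | ] := boolP [forall x in E, x ^ t == x].
  have [u [v [uE vE ou ov uv]]] := gen; exists u, v; split=> //.
  by constructor 1; split; apply/eqP; apply: (forall_inP allF).
case/forall_inPn => x xE xF.
have [allI | ] := boolP [forall x in E, x ^ t == x^-1].
  have [u [v [uE vE ou ov uv]]] := gen; exists u, v; split=> //.
  by constructor 2; split; apply/eqP; apply: (forall_inP allI).
case/forall_inPn => y yE yI.
(* Here [x] is not fixed and [y] is not inverted, so both elements are nontrivial; they project onto
   the eigenspaces of [t] for -1 and 1. *)
pose u := x^-1 * x ^ t; pose v := y * y ^ t.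
have uE : u \in E by rewrite groupM ?groupV ?xtE.
have vE : v \in E by rewrite groupM ?xtE.
have ut : u ^ t = u^-1.
  by rewrite conjMg conjVg conjtt [RHS]invMg invgK.
have vt : v ^ t = v by rewrite conjMg conjtt commE ?xtE.
have ou : #[u] = p.
  by apply: oE => //; apply: contra xF; rewrite (eq_sym (x ^ t)) (eq_mulVg1 x).
have ov : #[v] = p.
  by apply: oE => //; apply: contra yI; rewrite (eq_sym (y ^ t)) (eq_invg_mul y).
exists u, v; split; last by constructor 3.
split=> //; apply: prime_TIg; rewrite -?orderE ?ou // cycle_subG.
(* A power of [v] is fixed by [t], while [u] is inverted; equality would give [u^2 = 1], against the
   order [p > 2]. *)
apply: contraL p_gt2 => /cycleP[k uk].
have uu : u ^+ 2 = 1.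
  have : u ^ t = u by rewrite uk conjXg vt.
  by rewrite ut => /eqP; rewrite eq_invg_mul => /eqP.
by rewrite -leqNgt -ou dvdn_leq // order_dvdn uu.
Qed.

End InvolutionOnGroupOfOrderP2.

(** * Idempotents and the subgroup [G] in the five models *)

Section Models.
Local Open Scope ring_scope.

Section Coordinates.
Variables (A : zmodType) (C : leftSemiBraceType) (k : C -> A * 'Z_2).
Hypothesis k_inj : injective k.
Hypothesis kD : forall x y, k (sbadd x y) = ((k y).1, (k x).2 + (k y).2).
Hypothesis k1 : k 1%g = (0, 0).

(** Idempotency only constrains the second coordinate, where [g + g = g] forces [g = 0]. *)
Lemma sbE_model x : (x \in sbE C) = ((k x).2 == 0).
Proof.
rewrite inE -(inj_eq k_inj) kD [X in _ == X]surjective_pairing xpair_eqE eqxx /=.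
by rewrite -subr_eq0 addrK.
Qed.

(** Adding the neutral element on the right erases the first coordinate and keeps the second. *)
Lemma sbG_model x : (x \in sbG C) = ((k x).1 == 0).
Proof.
apply/imsetP/eqP => [[b _ ->] | x1]; first by rewrite kD k1.
by exists x => //; apply: k_inj; rewrite kD k1 /= addr0 -x1 -surjective_pairing.
Qed.

End Coordinates.

Variable p : nat.

(** All five models share this addition; the form with projections is the one used with [k := id] in
    the coordinate lemmas. *)
Lemma ZpZp_Z2_dirD (x y : ZpZp_Z2_dir p) : sbadd x y = (y.1, x.2 + y.2).
Proof. by case: x y => [? ?] []. Qed.

Lemma Zp2_Z2_dirD (x y : Zp2_Z2_dir p) : sbadd x y = (y.1, x.2 + y.2).
Proof. by case: x y => [? ?] []. Qed.

Lemma ZpZp_Z2_invD (x y : ZpZp_Z2_inv p) : sbadd x y = (y.1, x.2 + y.2).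
Proof. by case: x y => [[? ?] ?] [[]]. Qed.

Lemma ZpZp_Z2_semiD (x y : ZpZp_Z2_semi p) : sbadd x y = (y.1, x.2 + y.2).
Proof. by case: x y => [[? ?] ?] [[]]. Qed.

Lemma Zp2_Z2_invD (x y : Zp2_Z2_inv p) : sbadd x y = (y.1, x.2 + y.2).
Proof. by case: x y => [? ?] []. Qed.

Lemma ZpZp_Z2_dir_sets :
  sbE (ZpZp_Z2_dir p) = setX [set: 'Z_p * 'Z_p] [set 0] /\
  sbG (ZpZp_Z2_dir p) = setX [set (0, 0)] [set: 'Z_2].
Proof.
split; apply/setP => x.
  by rewrite (@sbE_model ('Z_p * 'Z_p)%type (ZpZp_Z2_dir p) id
    (@inj_id _) ZpZp_Z2_dirD) !inE.
by rewrite (@sbG_model ('Z_p * 'Z_p)%type (ZpZp_Z2_dir p) id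
    (@inj_id _) ZpZp_Z2_dirD) // !inE andbT.
Qed.

Lemma Zp2_Z2_dir_sets :
  sbE (Zp2_Z2_dir p) = setX [set: 'Z_(p ^ 2)] [set 0] /\
  sbG (Zp2_Z2_dir p) = setX [set 0] [set: 'Z_2].
Proof.
split; apply/setP => x.
  by rewrite (@sbE_model ('Z_(p ^ 2))%type (Zp2_Z2_dir p) id
    (@inj_id _) Zp2_Z2_dirD) !inE.
by rewrite (@sbG_model ('Z_(p ^ 2))%type (Zp2_Z2_dir p) id
    (@inj_id _) Zp2_Z2_dirD) // !inE andbT.
Qed.

Lemma ZpZp_Z2_inv_sets :
  sbE (ZpZp_Z2_inv p) = setX (setX [set: 'Z_p] [set: 'Z_p]) [set 0] /\
  sbG (ZpZp_Z2_inv p) = setX (setX [set 0] [set 0]) [set: 'Z_2].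
Proof.
split; apply/setP => x.
  by rewrite (@sbE_model ('Z_p * 'Z_p)%type (ZpZp_Z2_inv p) id
    (@inj_id _) ZpZp_Z2_invD) !inE.
rewrite (@sbG_model ('Z_p * 'Z_p)%type (ZpZp_Z2_inv p) id
    (@inj_id _) ZpZp_Z2_invD) // !inE andbT.
by case: x => [[e f] g].
Qed.

Lemma ZpZp_Z2_semi_sets :
  sbE (ZpZp_Z2_semi p) = setX (setX [set: 'Z_p] [set: 'Z_p]) [set 0] /\
  sbG (ZpZp_Z2_semi p) = setX (setX [set 0] [set 0]) [set: 'Z_2].
Proof.
split; apply/setP => x.
  by rewrite (@sbE_model ('Z_p * 'Z_p)%type (ZpZp_Z2_semi p) id
    (@inj_id _) ZpZp_Z2_semiD) !inE.
rewrite (@sbG_model ('Z_p * 'Z_p)%type (ZpZp_Z2_semi p) id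
    (@inj_id _) ZpZp_Z2_semiD) // !inE andbT.
by case: x => [[e f] g].
Qed.

Lemma Zp2_Z2_inv_sets :
  sbE (Zp2_Z2_inv p) = setX [set: 'Z_(p ^ 2)] [set 0] /\
  sbG (Zp2_Z2_inv p) = setX [set 0] [set: 'Z_2].
Proof.
split; apply/setP => x.
  by rewrite (@sbE_model ('Z_(p ^ 2))%type (Zp2_Z2_inv p) id
    (@inj_id _) Zp2_Z2_invD) !inE.
by rewrite (@sbG_model ('Z_(p ^ 2))%type (Zp2_Z2_inv p) id
    (@inj_id _) Zp2_Z2_invD) // !inE andbT.
Qed.

End Models.

(** * Matching [B] with a model from the action of [t] on generators of [E] *)

Section Classification.
Local Open Scope group_scope.
Variables (p : nat) (B : leftSemiBraceType) (t : B).
Hypotheses (p_gt1 : 1 < p) (B_lcanc : left_cancellative B).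
Hypotheses (cardB : #|B| = (2 * p ^ 2)%N) (cardE : #|sbE B| = (p ^ 2)%N).
Hypotheses (tG : t \in sbG B) (t1 : t != 1) (tt : t * t = 1) (ttD : sbadd t t = 1).

Let cardB_E : #|B| = (2 * #|sbE B|)%N. Proof. by rewrite cardE. Qed.

Let p2_gt1 : 1 < p ^ 2. Proof. by rewrite (@ltn_exp2l p 0 2). Qed.

Let card_Zn_Z2 n : 1 < n -> #|{: 'Z_n * 'Z_2}| = (2 * n)%N.
Proof. by move=> n1; rewrite card_prod !card_ord Zp_cast // mulnC. Qed.

Let card_ZpZp_Z2 : #|{: 'Z_p * 'Z_p * 'Z_2}| = (2 * p ^ 2)%N.
Proof. by rewrite !card_prod !card_ord Zp_cast // mulnC. Qed.

Section Cyclic.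
Variable x : B.
Hypotheses (xE : x \in sbE B) (ox : #[x] = (p ^ 2)%N).

Let iota (a : 'Z_(p ^ 2)) : B := x ^+ a.

Let xp2 : x ^+ (p ^ 2) = 1. Proof. by rewrite -ox expg_order. Qed.

Let iotaE a : iota a \in sbE B.
Proof. exact: (groupX (G := sbE_group B_lcanc)). Qed.

Lemma sb_isomorphic_Zp2_Z2_dir : x ^ t = x -> sb_isomorphic B (Zp2_Z2_dir p).
Proof.
move=> xt.
apply: (@sb_isomorphic_model B B_lcanc cardB_E ('Z_(p ^ 2))%type (Zp2_Z2_dir p)
          t id id iota) => //.
- by rewrite cardB -card_Zn_Z2.
- exact: Zp2_Z2_dirD.
- by move=> [e g] [f h] /=; rewrite if_same.
- exact: expg_Zp_inj.
- exact: expg_ZpD.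
by move=> a; rewrite /iota conjXg xt.
Qed.

Lemma sb_isomorphic_Zp2_Z2_inv : x ^ t = x^-1 -> sb_isomorphic B (Zp2_Z2_inv p).
Proof.
move=> xt.
apply: (@sb_isomorphic_model B B_lcanc cardB_E ('Z_(p ^ 2))%type (Zp2_Z2_inv p)
          t id (fun a => - a)%R iota) => //.
- by rewrite cardB -card_Zn_Z2.
- exact: Zp2_Z2_invD.
(* The sign [(-1) ^+ g] is evaluated at the representatives 0 and 1. *)
- move=> [e [[|[|m]] g]] [f h] //=; congr (_ + _, _)%R.
    by rewrite expr0 mul1r.
  by rewrite expr1 mulN1r.
- exact: expg_Zp_inj.
- exact: expg_ZpD.
by move=> a; rewrite /iota conjXg xt expgVn expg_ZpN.
Qed.

End Cyclic.

Section Noncyclic.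
Variables u v : B.
Hypotheses (uE : u \in sbE B) (vE : v \in sbE B) (ou : #[u] = p) (ov : #[v] = p).
Hypotheses (cuv : commute u v) (uvTI : <[u]> :&: <[v]> = 1).

Let iota (a : 'Z_p * 'Z_p) : B := u ^+ a.1 * v ^+ a.2.

Let up : u ^+ p = 1. Proof. by rewrite -ou expg_order. Qed.

Let vp : v ^+ p = 1. Proof. by rewrite -ov expg_order. Qed.

Let iotaE a : iota a \in sbE B.
Proof. by apply: (groupM (G := sbE_group B_lcanc)); apply: groupX. Qed.

Let iotaD : {morph iota : a b / (a + b)%R >-> a * b}.
Proof.
move=> [a b] [c d]; rewrite /iota /= !expg_ZpD // -!mulgA; congr (_ * _).
rewrite !mulgA; congr (_ * _).
by apply: commuteX; apply: commute_sym; apply: commuteX; apply: commute_sym.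
Qed.

(** Equal images give a power of [u] equal to a power of [v]; it is trivial by [uvTI], and the
    orders of [u] and [v] then identify the exponents. *)
Let iota_inj : injective iota.
Proof.
move=> [a b] [c d]; rewrite /iota /= => eq_ab.
have eq_uv : (u ^+ c)^-1 * u ^+ a = v ^+ d * (v ^+ b)^-1.
  by apply: (mulgI (u ^+ c)); rewrite mulKVg mulgA -eq_ab mulgK.
have : (u ^+ c)^-1 * u ^+ a \in <[u]> :&: <[v]>.
  by rewrite inE {2}eq_uv !groupM ?groupV ?mem_cycle.
rewrite uvTI => /set1P uu1.
have eq_ac : u ^+ a = u ^+ c by rewrite -[RHS]mulg1 -uu1 mulKVg.
have eq_bd : v ^+ b = v ^+ d by move: eq_ab; rewrite eq_ac => /mulgI.
by rewrite (expg_Zp_inj p_gt1 ou eq_ac) (expg_Zp_inj p_gt1 ov eq_bd).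
Qed.

Lemma sb_isomorphic_ZpZp_Z2_dir :
  u ^ t = u -> v ^ t = v -> sb_isomorphic B (ZpZp_Z2_dir p).
Proof.
move=> ut vt.
apply: (@sb_isomorphic_model B B_lcanc cardB_E ('Z_p * 'Z_p)%type (ZpZp_Z2_dir p)
          t id id iota) => //.
- by rewrite cardB -card_ZpZp_Z2.
- exact: ZpZp_Z2_dirD.
- by move=> [e g] [f h] /=; rewrite if_same.
by move=> a; rewrite /iota conjMg !conjXg ut vt.
Qed.

Lemma sb_isomorphic_ZpZp_Z2_inv :
  u ^ t = u^-1 -> v ^ t = v^-1 -> sb_isomorphic B (ZpZp_Z2_inv p).
Proof.
move=> ut vt.
apply: (@sb_isomorphic_model B B_lcanc cardB_E ('Z_p * 'Z_p)%type (ZpZp_Z2_inv p)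
          t id (fun a => - a)%R iota) => //.
- by rewrite cardB -card_ZpZp_Z2.
- exact: ZpZp_Z2_invD.
- move=> [[e1 f1] [[|[|m]] g]] [[e2 f2] h] //=; congr (_ + _, _ + _, _)%R;
    by rewrite ?expr0 ?mul1r ?expr1 ?mulN1r.
by move=> a; rewrite /iota conjMg !conjXg ut vt !expgVn !expg_ZpN.
Qed.

Lemma sb_isomorphic_ZpZp_Z2_semi :
  u ^ t = u^-1 -> v ^ t = v -> sb_isomorphic B (ZpZp_Z2_semi p).
Proof.
move=> ut vt.
apply: (@sb_isomorphic_model B B_lcanc cardB_E ('Z_p * 'Z_p)%type (ZpZp_Z2_semi p)
          t id (fun a => (- a.1, a.2)%R) iota) => //.
- by rewrite cardB -card_ZpZp_Z2.
- exact: ZpZp_Z2_semiD.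
- move=> [[e1 f1] [[|[|m]] g]] [[e2 f2] h] //=; congr (_ + _, _ + _, _)%R;
    by rewrite ?expr0 ?mul1r ?expr1 ?mulN1r.
by move=> a; rewrite /iota conjMg !conjXg ut vt !expgVn !expg_ZpN.
Qed.

End Noncyclic.

End Classification.

Theorem theorem5p9 (p : nat) (p_gt2 : 2 < p) (p_prime : prime p)
    (B : leftSemiBraceType) (B_lcanc : left_cancellative B)
    (cardB : #|B| = 2 * p ^ 2) (cardE : #|sbE B| = p ^ 2) :
   [/\ sb_isomorphic B (ZpZp_Z2_dir p),
       sbE (ZpZp_Z2_dir p) = setX [set: 'Z_p * 'Z_p] [set 0%R] &
       sbG (ZpZp_Z2_dir p) = setX [set (0%R, 0%R)] [set: 'Z_2]] \/
   [/\ sb_isomorphic B (Zp2_Z2_dir p),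
       sbE (Zp2_Z2_dir p) = setX [set: 'Z_(p ^ 2)] [set 0%R] &
       sbG (Zp2_Z2_dir p) = setX [set 0%R] [set: 'Z_2]] \/
   [/\ sb_isomorphic B (ZpZp_Z2_inv p),
       sbE (ZpZp_Z2_inv p) =
         setX (setX [set: 'Z_p] [set: 'Z_p]) [set 0%R] &
       sbG (ZpZp_Z2_inv p) =
         setX (setX [set 0%R] [set 0%R]) [set: 'Z_2]] \/
   [/\ sb_isomorphic B (ZpZp_Z2_semi p),
       sbE (ZpZp_Z2_semi p) =
         setX (setX [set: 'Z_p] [set: 'Z_p]) [set 0%R] &
       sbG (ZpZp_Z2_semi p) =
         setX (setX [set 0%R] [set 0%R]) [set: 'Z_2]] \/
   [/\ sb_isomorphic B (Zp2_Z2_inv p),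
       sbE (Zp2_Z2_inv p) = setX [set: 'Z_(p ^ 2)] [set 0%R] &
       sbG (Zp2_Z2_inv p) = setX [set 0%R] [set: 'Z_2]].
Proof.
have p_gt1 : 1 < p by apply: ltnW.
have cardB_E : #|B| = 2 * #|sbE B| by rewrite cardE.
have [t tG [t1 tt ttD]] := sbG_involution B_lcanc cardB_E.
pose E := sbE_group B_lcanc; have oE : #|E| = p ^ 2 := cardE.
have tN : t \in 'N(E)%g.
  by rewrite (subsetP (normal_norm (sbE_normal B_lcanc cardB_E))) ?inE.
have [cycE | ncE] := boolP (cyclic E).
  have [x xE [ox xt]] := cyclic_involution p_gt2 p_prime oE tN tt cycE.
  (* For cyclic [E], the signs 1 and -1 select the second and the fifth model. *)
  case: xt => xt; [right; left | do 4 right].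
    have [-> ->] := Zp2_Z2_dir_sets p; split=> //.
    exact: (sb_isomorphic_Zp2_Z2_dir p_gt1 _ _ _ tG t1 tt ttD xE ox xt).
  have [-> ->] := Zp2_Z2_inv_sets p; split=> //.
  exact: (sb_isomorphic_Zp2_Z2_inv p_gt1 _ _ _ tG t1 tt ttD xE ox xt).
have [u [v [[uE vE ou ov uv]]]] := noncyclic_involution p_gt2 p_prime oE tN tt ncE.
have cuv : commute u v by apply: (centsP (card_p2group_abelian p_prime oE)).
(* For noncyclic [E], the sign pairs (1, 1), (-1, -1) and (-1, 1) select the first, third and fourth
   models. *)
case=> -[ut vt]; [left | do 2 right; left | do 3 right; left].
- have [-> ->] := ZpZp_Z2_dir_sets p; split=> //.
  exact: (sb_isomorphic_ZpZp_Z2_dir p_gt1 _ _ _ tG t1 tt ttD uE vE ou ov cuv uv ut vt).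
- have [-> ->] := ZpZp_Z2_inv_sets p; split=> //.
  exact: (sb_isomorphic_ZpZp_Z2_inv p_gt1 _ _ _ tG t1 tt ttD uE vE ou ov cuv uv ut vt).
have [-> ->] := ZpZp_Z2_semi_sets p; split=> //.
exact: (sb_isomorphic_ZpZp_Z2_semi p_gt1 _ _ _ tG t1 tt ttD uE vE ou ov cuv uv ut vt).
Qed.
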